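(* Let $F\in C^1(\mathbb{R}_+\times\mathbb{R},\mathbb{R})$ and $v\in C^1(\mathbb{R}_+,\mathbb{R}_+)$ be such that for all $t\ge0$, $\frac{dv}{dt}(t)\le F(t,v(t))$. If there exist $t_0>0$ and $A>0$ such that for all $t\ge t_0$ and all $u\ge A$, $F(t,u)<0$, then there exists $B>0$ such that $v(t)\le B$ for all $t\ge0$, with $$B=\max\Big(\max_{t\in[0,t_0]}v(t),\,A\Big).$$
   Context: $\mathbb{R}_+=[0,+\infty)$. *)

(* Defs.v *)
From HB Require Import structures.
From mathcomp Require Import all_boot all_order all_algebra.
From mathcomp Require Import all_classical all_reals all_analysis.

Set Implicit Arguments.
Unset Strict Implicit.
Unset Printing Implicit Defensive.

Import Order.TTheory GRing.Theory Num.Theory.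
Import numFieldNormedType.Exports.

Local Open Scope classical_set_scope.
Local Open Scope ring_scope.

Definition Rplus (R : realType) : set R := [set t | 0 <= t].
Arguments Rplus : clear implicits.

(* Difference quotients at [x] along points of [D] only: at an interior point of
   [D] this is the usual derivative, at the endpoint 0 of [Rplus R] it is the
   right derivative.  Values of [f] outside [D] play no role when [x] is in [D]. *)
Definition derivable_within (R : realType) (D : set R) (f : R -> R) (x : R) : Prop :=
  cvg ((f y - f x) / (y - x) @[y --> within D x^']).

(* Total, like [derive1]; meaningful when [derivable_within D f x] holds. *)
Definition derive_within (R : realType) (D : set R) (f : R -> R) (x : R) : R :=
  lim ((f y - f x) / (y - x) @[y --> within D x^']).

(* A function of class C^1 on [0, +oo[ is represented by a function on [R] of
   which only the restriction to [Rplus R] matters. *)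
Definition C1_Rplus (R : realType) (v : R -> R) : Prop :=
  (forall t : R, 0 <= t -> derivable_within (Rplus R) v t) /\
  {within Rplus R, continuous (derive_within (Rplus R) v)}.

(* Class C^1 on [0, +oo[ x R: both partial derivatives exist (the one in the
   first variable being one-sided at 0) and are jointly continuous there. *)
Definition C1_Rplus_R (R : realType) (F : R * R -> R) : Prop :=
  [/\ (forall t u : R, 0 <= t -> derivable_within (Rplus R) (fun s => F (s, u)) t),
      (forall t u : R, 0 <= t -> derivable_within setT (fun w => F (t, w)) u),
      {within Rplus R `*` setT, continuous
        (fun p : R * R => derive_within (Rplus R) (fun s => F (s, p.2)) p.1)}
    & {within Rplus R `*` setT, continuous
        (fun p : R * R => derive_within setT (fun w => F (p.1, w)) p.2)}].

Definition is_max_on (R : realType) (D : set R) (f : R -> R) (m : R) : Prop :=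
  (f @` D) m /\ ubound (f @` D) m.

(* Main.v *)
Require Import Defs.
From HB Require Import structures.
From mathcomp Require Import all_boot all_order all_algebra.
From mathcomp Require Import all_classical all_reals all_analysis.

Import Order.TTheory GRing.Theory Num.Theory.
Import numFieldNormedType.Exports.

Local Open Scope classical_set_scope.
Local Open Scope ring_scope.

(** The bound holds because [v] cannot have a maximum at a late time with a high
    value.  Fix [t1 >= 0] and let [c] maximize [v] on [[0, t1]].  If [v c]
    exceeded [B], then [c] would lie beyond [t0], since [B] dominates [v] on
    [[0, t0]], and [v c] would be at least [A]; hence [v' c <= F (c, v c) < 0].
    But [v] lies below [v c] to the left of [c], so the difference quotients of
    [v] at [c] are nonnegative there and [v' c >= 0]
    ([derive_within_ge0_at_left_max]).  The argument also covers [c = t1],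
    because it looks at one side of [c] only.  The two maxima, on [[0, t0]] and
    on [[0, t1]], exist because [v] is continuous on [[0, +oo[], which follows
    from its differentiability ([derivable_within_cvg]). *)

(** Near [x] the function is [f x] plus the difference quotient times [y - x],
    and a convergent quotient makes the second term vanish in the limit. *)
Lemma derivable_within_cvg (R : realType) (D : set R) (f : R -> R) (x : R) :
  derivable_within D f x -> f y @[y --> within D (nbhs x)] --> f x.
Proof.
move=> df.
have y_x : y - x @[y --> within D x^'] --> (0 : R).
  have : y - x @[y --> x] --> x - x.
    by apply: cvgB; [exact: cvg_id | exact: cvg_cst].
  rewrite subrr => y_x.
  exact: (cvg_within_filter D (cvg_within_filter _ y_x)).
have f_punctured : f y @[y --> within D x^'] --> f x.
  have expansion_cvg :
      f x + (f y - f x) / (y - x) * (y - x) @[y --> within D x^'] --> f x.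
    rewrite -[X in _ --> X]addr0 -(mulr0 (derive_within D f x)).
    by apply: cvgD; [exact: cvg_cst | apply: cvgM].
  apply: (cvg_trans _ expansion_cvg); apply: near_eq_cvg.
  have : \forall y \near within D x^', y != x.
    exact: cvg_within (nbhs_dnbhs_neq x).
  by apply: filterS => y yx /=; rewrite divfK ?subr_eq0// subrKC.
(* The limit is known along the points other than [x]; at [x] itself the value
   is the limit, so it lies in every neighborhood of the limit. *)
move=> U fxU.
have U_punctured : \forall y \near x, y != x -> D y -> U (f y).
  exact: f_punctured U fxU.
suff : \forall y \near x, D y -> U (f y) by [].
apply: filterS U_punctured => y yU Dy.
by have [->|yx] := eqVneq y x; [exact: nbhs_singleton | exact: yU].
Qed.

(** The left limit computes the derivative as soon as [D] contains a left
    neighborhood of [x], whether or not [x] is interior to [D]. *)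
Lemma derive_within_ge0_at_left_max (R : realType) (D : set R) (f : R -> R)
    (x : R) :
  derivable_within D f x -> (\forall y \near x^'-, D y /\ f y <= f x) ->
  0 <= derive_within D f x.
Proof.
move=> df fx_max.
have left_within : x^'- `=>` within D x^'.
  move=> P DP; move: fx_max DP.
  rewrite /dnbhs /at_left !near_withinE /within /=.
  apply: filterS2 => y fx_max_y Py yx.
  by apply: Py; [rewrite lt_eqF | have [] := fx_max_y yx].
have left_cvg : (f y - f x) / (y - x) @[y --> x^'-] --> derive_within D f x.
  exact: cvg_trans (cvg_app _ left_within) df.
rewrite -(cvg_lim (@Rhausdorff R) left_cvg); apply: limr_ge.
  by apply/cvg_ex; exists (derive_within D f x).
near=> y; have [_ fyx] : D y /\ f y <= f x by near: y.
have y_le : y <= x by near: y; exact: nbhs_left_le.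
by rewrite -mulrNN -invrN !opprB divr_ge0 ?subr_ge0.
Unshelve. all: by end_near. Qed.

Lemma derivable_Rplus_attains_max {R : realType} {v : R -> R} {b : R} :
  (forall t, 0 <= t -> derivable_within (Rplus R) v t) -> 0 <= b ->
  exists2 c, c \in `[0, b] & forall t, t \in `[0, b] -> v t <= v c.
Proof.
move=> dv b_ge0; apply: EVT_max => //.
apply: (@continuous_subspaceW _ _ _ (Rplus R)).
  by move=> t /=; rewrite in_itv /= => /andP[].
apply/subspace_continuousP => t t_ge0.
by apply: derivable_within_cvg; exact: dv.
Qed.

Theorem lemma3 (R : realType) (F : R * R -> R) (v : R -> R)
  (F_C1 : C1_Rplus_R F)
  (v_C1 : C1_Rplus v)
  (v_ge0 : forall t : R, 0 <= t -> 0 <= v t)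
  (v_ineq : forall t : R, 0 <= t -> derive_within (Rplus R) v t <= F (t, v t))
  (t0 A : R) (t0_gt0 : 0 < t0) (A_gt0 : 0 < A)
  (F_lt0 : forall t u : R, t0 <= t -> A <= u -> F (t, u) < 0) :
  exists B : R,
    [/\ 0 < B,
        (forall t : R, 0 <= t -> v t <= B)
      & exists2 M : R, is_max_on `[0, t0] v M & B = Num.max M A].
Proof.
have [dv _] := v_C1.
have [m m_itv v_le] := derivable_Rplus_attains_max dv (ltW t0_gt0).
exists (Num.max (v m) A); split; first by rewrite lt_max A_gt0 orbT.
- move=> t1 t1_ge0.
  have [c c_itv v_le_c] := derivable_Rplus_attains_max dv t1_ge0.
  have /andP[c_ge0 c_le] : 0 <= c <= t1 by rewrite in_itv in c_itv.
  apply: (@le_trans _ _ (v c)); first by rewrite v_le_c// in_itv /= t1_ge0 lexx.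
  rewrite leNgt gt_max; apply/negP => /andP[vm_lt A_lt].
  have t0_lt : t0 < c.
    rewrite ltNge; apply/negP => c_le_t0.
    by move: vm_lt; rewrite ltNge v_le// in_itv /= c_ge0.
  have c_gt0 : 0 < c := lt_trans t0_gt0 t0_lt.
  have : 0 <= derive_within (Rplus R) v c.
    apply: derive_within_ge0_at_left_max; first exact: dv.
    near=> y.
    have y_ge0 : 0 <= y by near: y; exact: nbhs_left_ge.
    have y_le : y <= c by near: y; exact: nbhs_left_le.
    by split => //; apply: v_le_c; rewrite in_itv /= y_ge0 (le_trans y_le).
  rewrite leNgt => /negP; apply.
  exact: le_lt_trans (v_ineq c c_ge0) (F_lt0 c (v c) (ltW t0_lt) (ltW A_lt)).
- exists (v m) => //; split; first by exists m.
  by move=> _ [t t_itv <-]; exact: v_le.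
Unshelve. all: by end_near. Qed.
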